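(* There exists a fixed constant $C>0$ such that the following holds. Let $T$ be an Approximate Addition Tree on $n$ nodes with parameter $\delta\in(0,\frac12)$, with $y_v>0$ for all nodes $v$. For all $\varepsilon\in(0,\frac18)$ and all sufficiently large $n$, if $\delta<\frac{\varepsilon^2}{C\log^6 n}$ then $$\Pr\left[\exists v\in T:\ \max\left\{\frac{z_v}{y_v},\frac{y_v}{z_v}\right\}>1+\varepsilon\right]\le n^{-\log n}.$$
   Context: $\log$ denotes the base-2 logarithm. An Addition Tree is a full rooted binary tree (each non-leaf node has exactly two children) where each leaf $l$ has a given non-negative integer input $x_l$; exact values are $y_l=x_l$ at leaves and $y_v=y_{u_1}+y_{u_2}$ at an internal node $v$ with children $u_1,u_2$. The Approximate Addition Tree with parameter $\delta$ has approximate values $z_l=x_l$ at leaves and $z_v=z_{u_1}\oplus z_{u_2}$ at internal nodes, where $x_1\oplus x_2=0$ if $x_1=x_2=0$ and otherwise $x_1\oplus x_2=(1+\delta)^{\lfloor\log_{1+\delta}(x_1+x_2)+r\rfloor}$ with $r\in(0,1)$ chosen uniformly at random, independently at each node. Probabilities are over these random choices. *)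

(* Defs.v *)
From HB Require Import structures.
From mathcomp Require Import all_boot all_order all_algebra finmap.
From mathcomp Require Import all_classical all_reals all_analysis.

Set Implicit Arguments.
Unset Strict Implicit.
Unset Printing Implicit Defensive.

Import Order.TTheory GRing.Theory Num.Theory.
Import numFieldNormedType.Exports.

Local Open Scope classical_set_scope.
Local Open Scope ring_scope.

Inductive addition_tree : Type :=
  | Leaf (x : nat)
  | Node (t1 t2 : addition_tree).

(* A node of a tree is addressed by the path leading to it from the root:
   [::] is the root, false goes to the first child and true to the second. *)
Definition address : Type := seq bool.

Fixpoint nodes (t : addition_tree) : seq address :=
  match t with
  | Leaf _ => [:: [::]]
  | Node t1 t2 => [::] :: [seq false :: v | v <- nodes t1]
                       ++ [seq true :: v | v <- nodes t2]
  end.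

(* For v outside nodes t the value is the leaf at which the path v gets stuck;
   it is never used there. *)
Fixpoint subtree (t : addition_tree) (v : address) : addition_tree :=
  match t, v with
  | Node t1 t2, b :: w => subtree (if b then t2 else t1) w
  | _, _ => t
  end.

Definition is_leaf (t : addition_tree) : bool :=
  if t is Leaf _ then true else false.

Definition internal_nodes (t : addition_tree) : seq address :=
  [seq v <- nodes t | ~~ is_leaf (subtree t v)].

Fixpoint exact_root (t : addition_tree) : nat :=
  match t with
  | Leaf x => x
  | Node t1 t2 => (exact_root t1 + exact_root t2)%N
  end.

Definition exact_value (t : addition_tree) (v : address) : nat :=
  exact_root (subtree t v).

Definition logb (R : realType) (b x : R) : R := ln x / ln b.

Definition oplus (R : realType) (delta r x1 x2 : R) : R :=
  if (x1 == 0) && (x2 == 0) then 0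
  else (1 + delta) ^ Num.floor (logb (1 + delta) (x1 + x2) + r).

(* The argument r gives the random offset used at each (internal) node. *)
Fixpoint approx_root (R : realType) (delta : R) (r : address -> R)
    (t : addition_tree) : R :=
  match t with
  | Leaf x => x%:R
  | Node t1 t2 => oplus delta (r [::])
      (approx_root delta (fun w => r (false :: w)) t1)
      (approx_root delta (fun w => r (true :: w)) t2)
  end.

Definition approx_value (R : realType) (delta : R) (r : address -> R)
    (t : addition_tree) (v : address) : R :=
  approx_root delta (fun w => r (v ++ w)) (subtree t v).

Lemma subtree_cat t v w : subtree t (v ++ w) = subtree (subtree t v) w.
Proof. by elim: v t => [|b v IHv] [x|t1 t2] //=; case: w. Qed.

Lemma approx_value_leaf (R : realType) (delta : R) r t v x :
  subtree t v = Leaf x -> approx_value delta r t v = x%:R.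
Proof. by rewrite /approx_value => ->. Qed.

Lemma approx_value_internal (R : realType) (delta : R) r t v t1 t2 :
  subtree t v = Node t1 t2 ->
  approx_value delta r t v = oplus delta (r v)
    (approx_value delta r t (rcons v false))
    (approx_value delta r t (rcons v true)).
Proof.
move=> tv; rewrite /approx_value -!cats1 !subtree_cat tv /= cats0.
congr oplus.
- by case: t1 {tv} => *; congr approx_root; apply/funext => w; rewrite -catA.
- by case: t2 {tv} => *; congr approx_root; apply/funext => w; rewrite -catA.
Qed.

(* The equation is required on Borel sets only: as a set function, distribution
   P X is defined on all sets. The endpoints 0 and 1 have probability zero. *)
Definition uniform01 (R : realType) (d : measure_display)
    (T : measurableType d) (P : probability T R) (X : {RV P >-> R}) : Prop :=
  forall A : set R, measurable A ->
    distribution P X A = uniform_prob (@ltr01 R) A.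

Definition mutually_independent (R : realType) (d : measure_display)
    (T : measurableType d) (P : probability T R) (I : choiceType)
    (D : set I) (X : I -> {RV P >-> R}) : Prop :=
  forall (J : {fset I}) (A : I -> set R), [set` J] `<=` D ->
    (forall i, i \in J -> measurable (A i)) ->
    P (\bigcap_(i in [set` J]) (X i @^-1` A i)) =
    (\prod_(i <- J) P (X i @^-1` A i))%E.

(* Main.v *)
(** Rounding is unbiased on the logarithmic scale, so on the linear scale its
    bias is only of second order in [delta].  When the larger summand [y] is an
    internal node it is a power of [1 + delta], and then adding [x <= y] rounds
    upward with probability at most about [x / (delta y)].  Hence rounding [x + y]
    has variance [O(delta x y)] and bias [O(delta x)].  Since
    [(x + y)^2 = x^2 + y^2 + 2 x y], the variances of all nodes telescope to
    [O(delta y_v^2)]: the quantity [E exp (lam z - kap z^2)], [kap = 32 delta Lam^2],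
    is submultiplicative along the tree for [|lam| <= Lam], by independence of the
    two subtrees.  The bias is charged to the child of smaller Horton-Strahler
    number, by multiplying its [lam] with [1 + 2 delta]; as that number is at most
    [log n], the total bias factor is [(1 + 2 delta)^(log n)].  Markov's inequality
    with [Lam] proportional to [eps / (delta y_v)] bounds the failure probability at
    each node by [2 exp (- c eps^2 / delta)], and a union bound concludes. *)

Require Import Defs.
From mathcomp Require Import all_boot all_order all_algebra finmap.
From mathcomp Require Import all_classical all_reals all_analysis.
From mathcomp Require Import measurable_realfun.
From mathcomp Require Import ring lra.

Set Implicit Arguments.
Unset Strict Implicit.
Unset Printing Implicit Defensive.

Import Order.TTheory GRing.Theory Num.Theory.
Import numFieldNormedType.Exports.

Local Open Scope classical_set_scope.
Local Open Scope ring_scope.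

(** * Rounding to powers of 1 + delta *)

(** [expR (- x) >= 1 - x] gives [expR x * (1 - x) <= 1], while the quadratic times [1 - x] equals
    [1 + x^2 (1 - 2 x) >= 1]. *)
Lemma expR_le_quad (R : realType) (x : R) :
  x <= 1 / 2 -> expR x <= 1 + x + 2 * x ^+ 2.
Proof.
move=> hx.
have h1 : expR x * (1 - x) <= 1.
  rewrite -[leRHS](expRxMexpNx_1 x) ler_wpM2l ?expR_ge0//.
  exact: expR_ge1Dx.
have h2 : 1 <= (1 + x + 2 * x ^+ 2) * (1 - x).
  have -> : (1 + x + 2 * x ^+ 2) * (1 - x) = 1 + x ^+ 2 * (1 - 2 * x) by ring.
  by rewrite lerDl mulr_ge0 ?sqr_ge0//; lra.
rewrite -(@ler_pM2r _ (1 - x)); last by lra.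
exact: le_trans h1 h2.
Qed.

(** Convexity of the exponential, from its tangent at [p * a] evaluated at 0 and at [a]. *)
Lemma expR_convex_cst (R : realType) (p a : R) : 0 <= p <= 1 ->
  expR (p * a) <= 1 - p + p * expR a.
Proof.
move=> /andP[p0 p1]; set m := p * a.
have e0 : expR m * (1 - m) <= 1.
  by rewrite -[leRHS](expRxMexpNx_1 m) ler_wpM2l ?expR_ge0 ?expR_ge1Dx.
have ea : expR m * (1 + (a - m)) <= expR a.
  have -> : expR a = expR m * expR (a - m) by rewrite -expRD; congr expR; ring.
  by rewrite ler_wpM2l ?expR_ge0 ?expR_ge1Dx.
have -> : expR m = (1 - p) * (expR m * (1 - m)) + p * (expR m * (1 + (a - m))).
  by rewrite /m; ring.
by rewrite lerD ?ler_wpM2l// ler_piMr// subr_ge0.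
Qed.

Lemma ln1D_ge (R : realType) (x : R) : 0 < x -> x / (1 + x) <= ln (1 + x).
Proof.
move=> x0; have x1 : 0 < 1 + x by lra.
rewrite -lerN2 -lnV ?posrE//.
have e : (1 + x)^-1 = 1 + - (x / (1 + x)) by field; lra.
rewrite [X in ln X]e; apply: le_ln1Dx; rewrite ltrN2 ltr_pdivrMr//; lra.
Qed.

Section rounding.
Variables (R : realType) (delta : R).
Hypothesis delta01 : 0 < delta < 1 / 2.

Definition round_exp (s : R) : int := Num.floor (logb (1 + delta) s).

Definition round_down (s : R) : R := (1 + delta) ^ round_exp s.

Definition round_frac (s : R) : R :=
  logb (1 + delta) s - (round_exp s)%:~R.

(** The expectation of [g] at the rounded value of [s]: a uniform offset added to
    [logb (1 + delta) s] reaches the next integer with probability [round_frac s]. *)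
Definition step (s : R) (g : R -> R) : R :=
  (1 - round_frac s) * g (round_down s)
  + round_frac s * g ((1 + delta) * round_down s).

Let d0 : 0 < delta. Proof. by case/andP: delta01. Qed.
Let dlt : delta < 1 / 2. Proof. by case/andP: delta01. Qed.
Let b0 : 0 < 1 + delta. Proof. by rewrite addr_gt0. Qed.
Let lnb0 : 0 < ln (1 + delta). Proof. by rewrite ln_gt0// ltrDl. Qed.

Lemma exprz_expR (k : int) : (1 + delta) ^ k = expR (k%:~R * ln (1 + delta)).
Proof.
case: k => k; first by rewrite expRM_natl lnK ?posrE.
by rewrite NegzE -exprnN mulrNz mulNr expRN expRM_natl lnK ?posrE.
Qed.

Lemma round_frac_ge0 s : 0 <= round_frac s.
Proof. by rewrite subr_ge0 floor_le. Qed.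

Lemma round_frac_lt1 s : round_frac s < 1.
Proof.
by have := floorD1_gt (logb (1 + delta) s); rewrite ltrBlDl intrD.
Qed.

Lemma round_down_gt0 s : 0 < round_down s.
Proof. by rewrite exprz_gt0. Qed.

Lemma logb_ln s : ln s = logb (1 + delta) s * ln (1 + delta).
Proof. by rewrite /logb divfK// gt_eqF. Qed.

Lemma round_downE s : 0 < s ->
  s = round_down s * expR (round_frac s * ln (1 + delta)).
Proof.
move=> s0; rewrite /round_down exprz_expR -expRD -mulrDl /round_frac subrKC.
by rewrite -logb_ln lnK.
Qed.

(** With [u = round_down s] and [f = round_frac s], this and [round_down_upper] place the mean
    [u (1 + f delta)] of the rounded value between [s] and [s + u f delta^2]: the bias is of second
    order. *)
Lemma round_down_lower s : 0 < s ->
  round_down s * (1 + round_frac s * delta * (1 - delta)) <= s.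
Proof.
move=> s0; rewrite [leRHS]round_downE// ler_wpM2l ?(ltW (round_down_gt0 s))//.
apply: le_trans (expR_ge1Dx _); rewrite lerD2l -mulrA.
rewrite ler_wpM2l ?round_frac_ge0//.
apply: le_trans (ln1D_ge d0); rewrite ler_wpM2l ?(ltW d0)//.
rewrite -(@ler_pM2r _ (1 + delta))// mulVf ?gt_eqF//.
have := sqr_ge0 delta; have := d0; nra.
Qed.

Lemma round_down_upper s : 0 < s ->
  s <= round_down s * (1 + round_frac s * delta).
Proof.
move=> s0; rewrite [leLHS]round_downE// ler_wpM2l ?(ltW (round_down_gt0 s))//.
have h : 0 <= round_frac s <= 1.
  by rewrite round_frac_ge0 ltW// round_frac_lt1.
apply: le_trans (expR_convex_cst _ _) _ => //.
rewrite lnK ?posrE//; lra.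
Qed.

Lemma round_down_le s : 0 < s -> round_down s <= s.
Proof.
move=> s0; apply: le_trans (round_down_lower s0).
rewrite ler_peMr ?(ltW (round_down_gt0 s))// lerDl.
by rewrite !mulr_ge0 ?round_frac_ge0 ?ltW// subr_gt0; have := dlt; lra.
Qed.

Lemma round_up_gt s : 0 < s -> s < (1 + delta) * round_down s.
Proof.
move=> s0; apply: le_lt_trans (round_down_upper s0) _.
rewrite mulrC ltr_pM2r ?round_down_gt0// ltrD2l gtr_pMl// round_frac_lt1//.
Qed.

Lemma round_down_ge_exprz (m : int) s : (1 + delta) ^ m <= s ->
  (1 + delta) ^ m <= round_down s.
Proof.
move=> ms; rewrite /round_down ler_eXz2l ?ltrDl//.
rewrite /round_exp floor_ge_int /logb ler_pdivlMr//.
have m0 : 0 < (1 + delta) ^ m by rewrite exprz_gt0.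
rewrite -[leLHS]expRK -exprz_expR ler_ln// posrE//.
exact: lt_le_trans ms.
Qed.

(* When the larger summand is itself a power of 1 + delta, rounding the sum is
   rarely upward: the probability round_frac is at most about x / (y delta). *)
Lemma round_frac_small (m : int) x : 0 < x <= (1 + delta) ^ m ->
  round_down (x + (1 + delta) ^ m) * round_frac (x + (1 + delta) ^ m) * delta
  <= 2 * x.
Proof.
set y := (1 + delta) ^ m => /andP[x0 xy].
have y0 : 0 < y by rewrite /y exprz_gt0.
have dp := d0; have dl := dlt.
have s0 : 0 < x + y by rewrite addr_gt0.
set s := x + y in s0 *.
have f0 := round_frac_ge0 s; have f1 := round_frac_lt1 s.
have u0 := round_down_gt0 s.
have yu : y <= round_down s by apply: round_down_ge_exprz; rewrite lerDr ltW.
have := round_down_lower s0; have := round_down_upper s0.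
have us := round_down_le s0.
have [ux|xu] := leP (round_down s * delta) (2 * x).
  move=> _ _; apply: le_trans ux; rewrite mulrAC ler_piMr ?ltW//.
  by rewrite mulr_gt0.
move=> _ low.
(* round_down s = y, as the next power exceeds s *)
have uy : round_down s <= y.
  rewrite leNgt; apply/negP => yu'.
  (* A strictly larger power is at least [(1 + delta) y]; then [delta y <= x] and
     [round_down s <= 2 y], which contradicts [xu]. *)
  have m1 : y * (1 + delta) <= round_down s.
    rewrite -[in leLHS](expr1z (1 + delta)) -expfzDr ?gt_eqF//.
    rewrite ler_eXz2l ?ltrDl//.
    by move: yu'; rewrite ltr_eXz2l ?ltrDl// -lezD1.
  have : y * delta <= x by rewrite /s in us; lra.
  have : round_down s <= 2 * y by rewrite /s in us; lra.
  nra.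
have eu : round_down s = y by apply/eqP; rewrite eq_le uy.
rewrite eu in low *.
have es : s = x + y by [].
have h : y * round_frac s * delta * (1 - delta) <= x.
  by rewrite [leRHS](_ : x = s - y); [lra|rewrite es; ring].
have h0 : 0 <= y * round_frac s * delta by rewrite !mulr_ge0// ltW.
rewrite -/s; set A := y * round_frac s * delta in h h0 *; nra.
Qed.

Lemma step_ge0 s g : (forall z, 0 <= g z) -> 0 <= step s g.
Proof.
move=> g0; rewrite addr_ge0 ?mulr_ge0 ?round_frac_ge0// subr_ge0.
exact/ltW/round_frac_lt1.
Qed.

Definition gexp (lam kap z : R) : R := expR (lam * z - kap * z ^+ 2).

(** The tilt [th] is the slope at [s] of the concave exponent [lam z - kap z^2], which lies below
    its tangent. The exponential of the tangent is expanded to second order; the rounding error has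
    mean at most [u f delta^2] and second moment at most [2 u^2 f delta^2]. *)
Lemma step_gexp lam kap s : 0 < s -> 0 <= kap ->
  let th := lam - 2 * kap * s in
  `|th| * (round_down s * delta) <= 1 / 2 ->
  step s (gexp lam kap) <=
  expR (lam * s - kap * s ^+ 2
        + `|lam| * (round_down s * round_frac s * delta ^+ 2)
        + 4 * th ^+ 2 * (round_down s ^+ 2 * round_frac s * delta ^+ 2)).
Proof.
move=> s0 kap0 th hth.
have f0 := round_frac_ge0 s; have f1 := round_frac_lt1 s.
have dp := d0; have dl := dlt.
have u0 := round_down_gt0 s.
have low := round_down_lower s0; have upp := round_down_upper s0.
have us := round_down_le s0; have su := round_up_gt s0.
rewrite /step; set u := round_down s in u0 low upp us su hth *.
set f := round_frac s in f0 f1 low upp *.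
have gle W : gexp lam kap (s + W) <=
    expR (lam * s - kap * s ^+ 2) * expR (th * W).
  rewrite -expRD ler_expR /th -subr_ge0.
  have -> : lam * s - kap * s ^+ 2 + (lam - 2 * kap * s) * W -
    (lam * (s + W) - kap * (s + W) ^+ 2) = kap * W ^+ 2 by ring.
  by rewrite mulr_ge0 ?sqr_ge0.
have ud0 : 0 < u * delta by rewrite mulr_gt0.
have eW W : `|W| <= u * delta -> expR (th * W) <= 1 + th * W + 2 * (th * W) ^+ 2.
  move=> hW; apply: expR_le_quad; apply: le_trans (ler_norm _) _.
  by rewrite normrM; apply: le_trans hth; rewrite ler_wpM2l.
have fud : 0 <= u * (f * delta) by rewrite !mulr_ge0// ltW.
have fud' : u * (f * delta) <= u * delta.
  by rewrite ler_pM2l// ger_pMl// ltW.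
have W1 : - (u * (f * delta)) <= u - s <= 0 by apply/andP; split; lra.
have W2 : 0 <= (1 + delta) * u - s <= u * delta by apply/andP; split; lra.
have eW1 : `|u - s| <= u * delta.
  by rewrite ler_norml; apply/andP; split; lra.
have eW2 : `|(1 + delta) * u - s| <= u * delta.
  by rewrite ler_norml; apply/andP; split; lra.
have EW0 : 0 <= u + f * delta * u - s by lra.
have EW1 : u + f * delta * u - s <= u * f * delta ^+ 2 by lra.
(* The error is at most [u f delta] downward, and at most [u delta] upward with probability only
   [f]; so the second moment is linear in [f]. *)
have EW2 : (1 - f) * (u - s) ^+ 2 + f * ((1 + delta) * u - s) ^+ 2
    <= 2 * (u ^+ 2 * f * delta ^+ 2).
  have a1 : (u - s) ^+ 2 <= u ^+ 2 * f * delta ^+ 2.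
    have : (u - s) ^+ 2 <= (u * (f * delta)) ^+ 2.
      by rewrite -[leLHS]sqrrN lerXn2r ?nnegrE//; lra.
    move/le_trans; apply.
    have -> : (u * (f * delta)) ^+ 2 = u ^+ 2 * f * delta ^+ 2 * f by ring.
    rewrite ler_piMr ?(ltW f1)// !mulr_ge0 ?exprn_ge0//; exact: ltW.
  have a2 : ((1 + delta) * u - s) ^+ 2 <= (u * delta) ^+ 2.
    by rewrite lerXn2r ?nnegrE//; lra.
  have a3 : f * ((1 + delta) * u - s) ^+ 2 <= f * (u * delta) ^+ 2.
    by rewrite ler_wpM2l.
  have a4 : (1 - f) * (u - s) ^+ 2 <= (u - s) ^+ 2.
    by rewrite ler_piMl ?sqr_ge0//; lra.
  have -> : 2 * (u ^+ 2 * f * delta ^+ 2) =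
    u ^+ 2 * f * delta ^+ 2 + f * (u * delta) ^+ 2 by ring.
  lra.
rewrite -addrA [leRHS]expRD.
apply: (@le_trans _ _ (expR (lam * s - kap * s ^+ 2) *
   ((1 - f) * (1 + th * (u - s) + 2 * (th * (u - s)) ^+ 2) +
    f * (1 + th * ((1 + delta) * u - s)
         + 2 * (th * ((1 + delta) * u - s)) ^+ 2)))).
  rewrite mulrDr lerD//.
    rewrite mulrCA ler_wpM2l//; first lra.
    have := gle (u - s); rewrite subrKC => /le_trans; apply.
    by rewrite ler_wpM2l ?expR_ge0 ?eW.
  rewrite mulrCA ler_wpM2l//.
  have := gle ((1 + delta) * u - s); rewrite subrKC => /le_trans; apply.
  by rewrite ler_wpM2l ?expR_ge0 ?eW.
rewrite ler_wpM2l ?expR_ge0//; apply: le_trans (expR_ge1Dx _).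
rewrite [leLHS](_ : _ = 1 + (th * (u + f * delta * u - s) + 2 * th ^+ 2 *
   ((1 - f) * (u - s) ^+ 2 + f * ((1 + delta) * u - s) ^+ 2))); last by ring.
rewrite lerD2l lerD//.
  apply: (@le_trans _ _ (`|lam| * (u + f * delta * u - s))).
    rewrite ler_wpM2r//; apply: le_trans (ler_norm lam).
    by rewrite /th gerBl !mulr_ge0// ltW.
  by rewrite ler_wpM2l.
have -> : 4 * th ^+ 2 * (u ^+ 2 * f * delta ^+ 2) =
  2 * th ^+ 2 * (2 * (u ^+ 2 * f * delta ^+ 2)) by ring.
by rewrite ler_wpM2l// mulr_ge0 ?sqr_ge0.
Qed.

End rounding.

(** * Exponential moments of the approximate value *)

(* The Horton-Strahler number. *)
Fixpoint rank (t : addition_tree) : nat :=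
  match t with
  | Leaf _ => 0
  | Node a b => if rank a == rank b then (rank a).+1 else maxn (rank a) (rank b)
  end.

Lemma size_nodes_node a b :
  size (nodes (Node a b)) = (size (nodes a) + size (nodes b)).+1.
Proof. by rewrite /= size_cat !size_map. Qed.

(** The rank increases only where two subtrees of equal rank meet, and there the lower bound on the
    size doubles. *)
Lemma expn_rank_le t : (2 ^ rank t <= size (nodes t))%N.
Proof.
elim: t => [//|a IHa b IHb]; rewrite size_nodes_node /=.
case: eqP => [e|_]; first by rewrite expnS mul2n -addnn ltnW// ltnS {2}e leq_add.
apply: leqW; case: (leqP (rank a) (rank b)) => _.
- exact: leq_trans IHb (leq_addl _ _).
- exact: leq_trans IHa (leq_addr _ _).
Qed.

Definition positive_tree (t : addition_tree) : Prop :=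
  forall v, v \in nodes t -> (0 < exact_value t v)%N.

Lemma positive_tree_node a b :
  positive_tree (Node a b) -> positive_tree a /\ positive_tree b.
Proof.
move=> h; split=> v hv.
- by apply: (h (false :: v)); rewrite inE mem_cat map_f ?orbT.
- by apply: (h (true :: v)); rewrite inE mem_cat map_f ?orbT.
Qed.

Lemma positive_tree_root t : positive_tree t -> (0 < exact_root t)%N.
Proof. by move=> /(_ [::]); case: t => [x|a b]; apply; rewrite ?inE. Qed.

Section average.
Variables (R : realType) (delta : R).
Hypothesis delta01 : 0 < delta < 1 / 2.

Let d0 : 0 < delta. Proof. by case/andP: delta01. Qed.
Let dlt : delta < 1 / 2. Proof. by case/andP: delta01. Qed.
Let b0 : 0 < 1 + delta. Proof. by rewrite addr_gt0. Qed.

(* The expectation of g (z_t), unfolded along the tree. *)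
Fixpoint avg (t : addition_tree) (g : R -> R) : R :=
  match t with
  | Leaf x => g x%:R
  | Node a b => avg a (fun x => avg b (fun y => step delta (x + y) g))
  end.

(** For a positive tree, a finite list containing every value of [z_t] for offsets in [0, 1),
    possibly with repetitions. *)
Fixpoint supp (t : addition_tree) : seq R :=
  match t with
  | Leaf x => [:: x%:R]
  | Node a b => [seq round_down delta (x + y) | x <- supp a, y <- supp b] ++
      [seq (1 + delta) * round_down delta (x + y) | x <- supp a, y <- supp b]
  end.

Lemma supp_gt0 t z : positive_tree t -> z \in supp t -> 0 < z.
Proof.
case: t => [x|a b] ht.
  by rewrite inE => /eqP ->; rewrite ltr0n; exact: positive_tree_root ht.
rewrite /= mem_cat => /orP[] /allpairsP[[x y] [_ _ ->]] /=.
  exact: round_down_gt0.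
by rewrite mulr_gt0// round_down_gt0.
Qed.

(** Makes [round_frac_small] applicable when the larger summand comes from an internal node. *)
Lemma supp_exprz t z : ~~ is_leaf t -> z \in supp t ->
  exists m : int, z = (1 + delta) ^ m.
Proof.
case: t => [//|a b] _; rewrite /= mem_cat => /orP[] /allpairsP[[x y] [_ _ ->]] /=.
  by eexists; reflexivity.
by exists (1 + round_exp delta (x + y)); rewrite expfzDr ?gt_eqF// expr1z.
Qed.

Lemma ler_step s g h : g (round_down delta s) <= h (round_down delta s) ->
  g ((1 + delta) * round_down delta s) <= h ((1 + delta) * round_down delta s) ->
  step delta s g <= step delta s h.
Proof.
move=> h1 h2; rewrite /step lerD// ler_wpM2l ?round_frac_ge0//.
by rewrite subr_ge0 ltW// round_frac_lt1.
Qed.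

Lemma ler_avg t g h : (forall z, z \in supp t -> g z <= h z) ->
  avg t g <= avg t h.
Proof.
elim: t g h => [x|a IHa b IHb] g h gh /=; first by apply: gh; rewrite inE.
apply: IHa => x xa; apply: IHb => y yb; apply: ler_step; apply: gh.
- by rewrite mem_cat (allpairs_f (fun x y => round_down delta (x + y))).
- rewrite mem_cat orbC.
  by rewrite (allpairs_f (fun x y => (1 + delta) * round_down delta (x + y))).
Qed.

Lemma eq_avg t g h : (forall z, z \in supp t -> g z = h z) ->
  avg t g = avg t h.
Proof.
by move=> gh; apply/eqP; rewrite eq_le !ler_avg// => z zt; rewrite gh.
Qed.

Lemma avgZ t c g : avg t (fun z => c * g z) = c * avg t g.
Proof.
elim: t g => [x|a IHa b IHb] g //=.
rewrite -IHa; apply: eq_avg => x _; rewrite -IHb; apply: eq_avg => y _.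
by rewrite /step; ring.
Qed.

Lemma avgD t g h : avg t (fun z => g z + h z) = avg t g + avg t h.
Proof.
elim: t g h => [x|a IHa b IHb] g h //=.
rewrite -IHa; apply: eq_avg => x _; rewrite -IHb; apply: eq_avg => y _.
by rewrite /step; ring.
Qed.

Lemma avg_ge0 t g : (forall z, 0 <= g z) -> 0 <= avg t g.
Proof.
move=> g0; have := avgZ t 0 g; rewrite mul0r => <-.
by apply: ler_avg => z _; rewrite mul0r.
Qed.

Lemma avg_sum t (I : Type) (s : seq I) (F : I -> R -> R) :
  avg t (fun z => \sum_(i <- s) F i z) = \sum_(i <- s) avg t (F i).
Proof.
elim: s => [|i s IHs].
  rewrite big_nil -[RHS](mul0r (avg t (fun=> 0))) -avgZ.
  by apply: eq_avg => z _; rewrite big_nil mul0r.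
rewrite big_cons -IHs -avgD; apply: eq_avg => z _; by rewrite big_cons.
Qed.

(** The averages of indicators serve as point masses; in this form [avg] is compared with actual
    probabilities. *)
Lemma avg_point t g :
  avg t g = \sum_(x <- undup (supp t)) g x * avg t (fun z => (z == x)%:R).
Proof.
under eq_bigr do rewrite -avgZ; rewrite -avg_sum; apply: eq_avg => z zt.
rewrite (bigD1_seq z) ?undup_uniq ?mem_undup//= eqxx mulr1 big1 ?addr0// => x.
by rewrite eq_sym => /negbTE ->; rewrite mulr0.
Qed.

(** * Submultiplicativity of the discounted exponential moment *)

Section mgf.
Variables (Lam B : R).
Hypotheses (Lam0 : 0 < Lam) (LamB : 96 * delta * Lam * B <= 1).

Let kap : R := 32 * delta * Lam ^+ 2.

Let kap0 : 0 <= kap.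
Proof. by rewrite /kap !mulr_ge0// ?exprn_ge0// ltW. Qed.

(* Cutting off at B keeps the tilt lam - 2 kap s of step_gexp bounded. Leaves are
   not discounted: the spare kap x^2 pays for the rounding at the parent of a
   dominating leaf, which need not be a power of 1 + delta. *)
Definition weight (leaf : bool) (lam z : R) : R :=
  if leaf then expR (lam * z) else if z <= B then gexp lam kap z else 0.

Lemma weight_ge0 l lam z : 0 <= weight l lam z.
Proof.
by rewrite /weight /gexp; case: l; rewrite ?expR_ge0//; case: ifP; rewrite ?expR_ge0.
Qed.

(** Rounding cannot fall below a power of [1 + delta] that [s] has reached, so both outcomes are
    beyond the cutoff. *)
Lemma step_weight0 s lam (m : int) : (1 + delta) ^ m <= s ->
  B < (1 + delta) ^ m -> step delta s (weight false lam) = 0.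
Proof.
move=> ms Bm; have mu := round_down_ge_exprz delta01 ms.
have u0 := round_down_gt0 delta01 s; have dp := d0.
have Bu : B < round_down delta s by apply: lt_le_trans mu.
by rewrite /step /weight /= !ifF ?mulr0 ?addr0//; apply/negbTE; rewrite -ltNge//; nra.
Qed.

Lemma step_weight s lam : 0 < s -> `|lam| <= Lam ->
  step delta s (weight false lam) <=
  expR (lam * s - kap * s ^+ 2
   + `|lam| * (round_down delta s * round_frac delta s * delta ^+ 2)
   + kap * (round_down delta s ^+ 2 * round_frac delta s * delta) / 2).
Proof.
move=> s0 hl; have dp := d0; have dl := dlt.
have f0 := round_frac_ge0 delta s; have f1 := round_frac_lt1 delta s.
have u0 := round_down_gt0 delta01 s.
have [uB|uB] := leP (round_down delta s) B; last first.
  rewrite (@step_weight0 s lam (round_exp delta s)) ?expR_ge0//.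
  exact: round_down_le.
have su := round_up_gt delta01 s0.
have us := round_down_le delta01 s0.
have sB : s <= 3 / 2 * B by nra.
(* The constant 96 is 64 times 3/2: as [2 kap = 64 delta Lam^2] and [s <= 3 B / 2], the tilt differs
   from [lam] by at most [Lam]. *)
have ks : 2 * kap * s <= Lam.
  have -> : 2 * kap * s = 64 * delta * Lam * s * Lam by rewrite /kap; ring.
  rewrite -[leRHS]mul1r ler_pM2r//; apply: le_trans LamB.
  have -> : 96 * delta * Lam * B = 64 * delta * Lam * (3 / 2 * B) by field.
  by rewrite ler_pM2l// !mulr_gt0.
have ks0 : 0 <= 2 * kap * s by rewrite !mulr_ge0// ltW.
have thL : `|lam - 2 * kap * s| <= 2 * Lam.
  by apply: le_trans (ler_normB _ _) _; rewrite (ger0_norm ks0); lra.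
have LB : Lam * (B * delta) <= 1 / 96 by have := LamB; lra.
have thu : `|lam - 2 * kap * s| * (round_down delta s * delta) <= 1 / 2.
  apply: (@le_trans _ _ (2 * Lam * (B * delta))); last by lra.
  by apply: ler_pM => //; [rewrite mulr_ge0 ?ltW|rewrite ler_pM2r].
apply: (@le_trans _ _ (step delta s (gexp lam kap))).
  by apply: ler_step; rewrite /weight; case: ifP => //; rewrite expR_ge0.
apply: le_trans (step_gexp _ s0 kap0 thu) _ => //.
rewrite ler_expR lerD2l.
have th2 : (lam - 2 * kap * s) ^+ 2 <= 4 * Lam ^+ 2.
  have -> : 4 * Lam ^+ 2 = (2 * Lam) ^+ 2 by ring.
  by rewrite -real_normK ?num_real// lerXn2r ?nnegrE ?mulr_ge0// ltW.
(* The 32 in [kap] is twice the 16 of [4 th^2 <= 16 Lam^2], which produces the factor 1/2 here. *)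
have -> : kap * (round_down delta s ^+ 2 * round_frac delta s * delta) / 2 =
  4 * (4 * Lam ^+ 2) * (round_down delta s ^+ 2 * round_frac delta s * delta ^+ 2).
  by rewrite /kap; field.
rewrite ler_wpM2r//; first by rewrite !mulr_ge0 ?exprn_ge0// ltW.
by rewrite ler_pM2l.
Qed.

(** The second-order cost is at most [kap u x <= kap (x + y) x <= 2 kap x y], the cross term of
    [kap (x + y)^2], so both children keep their full discount. The bias is proportional to the
    smaller summand. *)
Lemma step_weight_internal x (m : int) lam : `|lam| <= Lam ->
  let y := (1 + delta) ^ m in 0 < x <= y ->
  step delta (x + y) (weight false lam) <=
  expR (lam * (x + y) + `|lam| * (2 * delta * x) - kap * x ^+ 2 - kap * y ^+ 2).
Proof.
move=> hl y hxy; have /andP[x0 xy] := hxy; have dp := d0; have dl := dlt.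
have y0 : 0 < y by apply: lt_le_trans xy.
have s0 : 0 < x + y by rewrite addr_gt0.
apply: le_trans (step_weight s0 hl) _; rewrite ler_expR.
have ufd := round_frac_small delta01 hxy; rewrite -/y in ufd.
have u0 := round_down_gt0 delta01 (x + y); have us := round_down_le delta01 s0.
have f0 := round_frac_ge0 delta (x + y).
set u := round_down _ _ in ufd u0 us *; set f := round_frac _ _ in ufd f0 *.
have h1 : `|lam| * (u * f * delta ^+ 2) <= `|lam| * (2 * delta * x).
  rewrite ler_wpM2l//.
  have -> : u * f * delta ^+ 2 = delta * (u * f * delta) by ring.
  have -> : 2 * delta * x = delta * (2 * x) by ring.
  by rewrite ler_pM2l.
have h2 : kap * (u ^+ 2 * f * delta) / 2 <= kap * (2 * x * y).
  have -> : kap * (u ^+ 2 * f * delta) / 2 = kap * (u * ((u * f * delta) / 2)).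
    by field.
  rewrite ler_wpM2l//; have : u * ((u * f * delta) / 2) <= (x + y) * x.
    apply: ler_pM => //; [exact: ltW| |lra].
    by rewrite !mulr_ge0// ltW.
  nra.
have -> : kap * (x + y) ^+ 2 = kap * x ^+ 2 + kap * y ^+ 2 + kap * (2 * x * y).
  by ring.
lra.
Qed.

(** Here [round_frac] may be large. The share [kap y^2], which a leaf does not retain, covers the
    cost [kap u^2 f delta / 2], because [u <= 2 y] and [delta < 1 / 2]. *)
Lemma step_weight_leaf x y lam : `|lam| <= Lam -> 0 < x <= y ->
  step delta (x + y) (weight false lam) <=
  expR (lam * (x + y) + `|lam| * (2 * delta * y) - kap * x ^+ 2).
Proof.
move=> hl /andP[x0 xy]; have dp := d0; have dl := dlt.
have y0 : 0 < y by apply: lt_le_trans xy.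
have s0 : 0 < x + y by rewrite addr_gt0.
apply: le_trans (step_weight s0 hl) _; rewrite ler_expR.
have u0 := round_down_gt0 delta01 (x + y); have us := round_down_le delta01 s0.
have f0 := round_frac_ge0 delta (x + y); have f1 := round_frac_lt1 delta (x + y).
set u := round_down _ _ in u0 us *; set f := round_frac _ _ in f0 f1 *.
have uf : u * f <= 2 * y.
  by apply: (@le_trans _ _ u); [rewrite ler_piMr// ltW|lra].
have uf0 : 0 <= u * f by rewrite mulr_ge0// ltW.
have h1 : `|lam| * (u * f * delta ^+ 2) <= `|lam| * (2 * delta * y).
  rewrite ler_wpM2l//.
  have -> : u * f * delta ^+ 2 = delta * (u * f * delta) by ring.
  have -> : 2 * delta * y = delta * (2 * y) by ring.
  by rewrite ler_pM2l//; nra.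
have h2 : kap * (u ^+ 2 * f * delta) / 2 <= kap * y ^+ 2.
  have -> : kap * (u ^+ 2 * f * delta) / 2 = kap * (u * (u * f) * delta / 2).
    by field.
  rewrite ler_wpM2l//.
  have : u * (u * f) <= (2 * y) * (2 * y) by apply: ler_pM => //; lra.
  have : 0 <= u * (u * f) by rewrite mulr_ge0// ltW.
  set A := u * (u * f) => A0; rewrite expr2; nra.
have : 0 <= kap * (x * y) by rewrite !mulr_ge0// ltW.
have -> : kap * (x + y) ^+ 2 = kap * x ^+ 2 + kap * y ^+ 2 + 2 * (kap * (x * y)).
  by ring.
lra.
Qed.

(** The flag [c] tells whether the child pays for the bias, which raises the exponent by a multiple
    of the absolute value of [lam], whatever its sign. *)
Definition boost (c : bool) (lam : R) : R :=
  if c then lam + 2 * delta * `|lam| else lam.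

Lemma boost_ge c lam : lam <= boost c lam.
Proof.
case: c => //; rewrite /boost lerDl !mulr_ge0//; exact: ltW.
Qed.

Lemma weight_lower l lam z : (~~ l -> z <= B) ->
  expR (lam * z - kap * z ^+ 2) <= weight l lam z.
Proof.
case: l => /= h; last by rewrite h.
by rewrite ler_expR gerBl mulr_ge0// sqr_ge0.
Qed.

(** A leaf as larger child must pay itself, its bias being proportional to [y]. For an internal [y]
    the bias is proportional to [x <= y], so either child can pay. If an internal child exceeds [B],
    the left side vanishes. *)
Lemma step_weight_le_sorted lx ly cx cy x y lam : `|lam| <= Lam ->
  0 < x <= y ->
  (~~ lx -> exists m : int, x = (1 + delta) ^ m) ->
  (~~ ly -> exists m : int, y = (1 + delta) ^ m) ->
  cx || cy -> (ly -> cy) ->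
  step delta (x + y) (weight false lam) <=
  weight lx (boost cx lam) x * weight ly (boost cy lam) y.
Proof.
move=> hl hxy; have /andP[x0 xy] := hxy => Lx Ly cxy lycy; have dp := d0.
have y0 : 0 < y by apply: lt_le_trans xy.
have xs : x <= x + y by rewrite lerDl ltW.
have ys : y <= x + y by rewrite lerDr ltW.
have WW : 0 <= weight lx (boost cx lam) x * weight ly (boost cy lam) y.
  by rewrite mulr_ge0 ?weight_ge0.
have [|xB] := boolP (~~ lx ==> (x <= B)); last first.
  move: xB; rewrite negb_imply -ltNge => /andP[/Lx[m em] xB].
  by rewrite (@step_weight0 _ _ m) -?em.
move=> /implyP xB.
have [|yB] := boolP (~~ ly ==> (y <= B)); last first.
  move: yB; rewrite negb_imply -ltNge => /andP[/Ly[m em] yB].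
  by rewrite (@step_weight0 _ _ m) -?em.
move=> /implyP yB.
have ax : lam * x <= boost cx lam * x by rewrite ler_wpM2r ?boost_ge// ltW.
have ay : lam * y <= boost cy lam * y by rewrite ler_wpM2r ?boost_ge// ltW.
have bd : 0 <= 2 * delta * `|lam| by rewrite !mulr_ge0// ltW.
case: (boolP ly) => lyE.
  apply: le_trans (step_weight_leaf hl hxy) _.
  apply: (@le_trans _ _ (expR (boost cx lam * x - kap * x ^+ 2)
      * expR (boost cy lam * y))).
    by rewrite -expRD ler_expR (lycy lyE) {2}/boost; lra.
  by apply: ler_pM; rewrite ?expR_ge0//; exact: weight_lower.
have [m em] := Ly lyE.
rewrite em in hxy; have := step_weight_internal hl hxy; rewrite -em => /le_trans.
apply; apply: (@le_trans _ _ (expR (boost cx lam * x - kap * x ^+ 2) *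
    expR (boost cy lam * y - kap * y ^+ 2))).
  rewrite -expRD ler_expR; case/orP: cxy => ce; rewrite ce in ax ay *.
    by rewrite {1}/boost; lra.
  have : 2 * delta * `|lam| * x <= 2 * delta * `|lam| * y by rewrite ler_wpM2l.
  by rewrite {2}/boost; lra.
by apply: ler_pM; rewrite ?expR_ge0//; apply: weight_lower => // _; exact: yB.
Qed.

Lemma step_weight_le lx ly cx cy x y lam : `|lam| <= Lam ->
  0 < x -> 0 < y ->
  (~~ lx -> exists m : int, x = (1 + delta) ^ m) ->
  (~~ ly -> exists m : int, y = (1 + delta) ^ m) ->
  cx || cy -> (lx -> cx) -> (ly -> cy) ->
  step delta (x + y) (weight false lam) <=
  weight lx (boost cx lam) x * weight ly (boost cy lam) y.
Proof.
move=> hl x0 y0 Lx Ly c hx hy; have [xy|/ltW yx] := leP x y.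
  by apply: step_weight_le_sorted => //; rewrite x0.
by rewrite addrC mulrC; apply: step_weight_le_sorted; rewrite ?y0 1?orbC.
Qed.

(** A paying child has rank below [r], so its extra factor [1 + 2 delta] fits into the missing
    power. *)
Lemma boost_exponent (c : bool) lam (k r : nat) : (k + c <= r)%N ->
  `|boost c lam| * (1 + 2 * delta) ^+ k <= `|lam| * (1 + 2 * delta) ^+ r /\
  boost c lam + `|boost c lam| * ((1 + 2 * delta) ^+ k - 1) <=
  lam + `|lam| * ((1 + 2 * delta) ^+ r - 1).
Proof.
move=> kr; have dp := d0.
have q1 j : 1 <= (1 + 2 * delta) ^+ j by rewrite exprn_ege1//; lra.
have hle : (1 + 2 * delta) ^+ (k + c) <= (1 + 2 * delta) ^+ r.
  by rewrite ler_weXn2l//; lra.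
have h := ler_wpM2l (normr_ge0 lam) hle.
case: c {kr} hle h; rewrite ?addn1 ?addn0 /boost => _ h; last by split; lra.
have bl : `|lam + 2 * delta * `|lam| | <= `|lam| * (1 + 2 * delta).
  apply: le_trans (ler_normD _ _) _.
  by rewrite (ger0_norm (_ : 0 <= 2 * delta * `|lam|)) ?mulr_ge0//; lra.
rewrite exprS in h.
have qk0 : 0 <= (1 + 2 * delta) ^+ k by rewrite (le_trans ler01 (q1 k)).
have qk1 : 0 <= (1 + 2 * delta) ^+ k - 1 by rewrite subr_ge0.
have h1 := ler_wpM2r qk0 bl; have h2 := ler_wpM2r qk1 bl.
by split; lra.
Qed.

(** By [step_weight_le] the integrand splits into one factor per child, and the nested averages
    become a product. The children of rank below [r] pay: there is at least one, and every leaf is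
    among them. *)
Lemma avg_weight_le t lam : positive_tree t ->
  `|lam| * (1 + 2 * delta) ^+ rank t <= Lam ->
  avg t (weight (is_leaf t) lam) <=
  expR ((lam + `|lam| * ((1 + 2 * delta) ^+ rank t - 1)) * (exact_root t)%:R).
Proof.
have dp := d0.
elim: t lam => [x|a IHa b IHb] lam pt hl.
  by rewrite /= expr0 subrr mulr0 addr0.
have [pa pb] := positive_tree_node pt.
set r := rank (Node a b) in hl *.
have q1 : 1 <= (1 + 2 * delta) ^+ r by rewrite exprn_ege1//; lra.
have hl' : `|lam| <= Lam by apply: le_trans hl; rewrite ler_peMr.
pose ca := (rank a < r)%N; pose cb := (rank b < r)%N.
have [ra rb] : (rank a <= r)%N /\ (rank b <= r)%N.
  rewrite /r /=; case: eqP => [->//|_]; by rewrite leq_maxl leq_maxr.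
have cab : ca || cb.
  rewrite /ca /cb /r /=; case: eqP => [->|/eqP ab]; first by rewrite ltnSn.
  by rewrite !leq_max !ltnn orbF /= -neq_ltn.
have rpos : (0 < r)%N by case/orP: cab; exact: leq_ltn_trans.
have la : is_leaf a -> ca by rewrite /ca; case: (a).
have lb : is_leaf b -> cb by rewrite /cb; case: (b).
rewrite /is_leaf -/(is_leaf _) /=.
apply: (@le_trans _ _ (avg a (fun x => avg b (fun y =>
  weight (is_leaf a) (boost ca lam) x * weight (is_leaf b) (boost cb lam) y)))).
  apply: ler_avg => x xa; apply: ler_avg => y yb; apply: step_weight_le => //.
  - exact: supp_gt0 xa.
  - exact: supp_gt0 yb.
  - by move=> h; apply: supp_exprz xa.
  - by move=> h; apply: supp_exprz yb.
rewrite (eq_avg (h := fun x => avg b (weight (is_leaf b) (boost cb lam)) *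
   weight (is_leaf a) (boost ca lam) x)); last by move=> x _; rewrite avgZ mulrC.
rewrite avgZ natrD mulrDr expRD mulrC.
have [ka1 ka2] := @boost_exponent ca lam (rank a) r
  ltac:(by rewrite /ca; case: ltnP ra; rewrite ?addn1 ?addn0).
have [kb1 kb2] := @boost_exponent cb lam (rank b) r
  ltac:(by rewrite /cb; case: ltnP rb; rewrite ?addn1 ?addn0).
have wl t' l m : 0 <= avg t' (weight l m) by apply: avg_ge0; exact: weight_ge0.
apply: ler_pM => //.
- apply: le_trans (IHa _ pa (le_trans ka1 hl)) _.
  by rewrite ler_expR ler_wpM2r.
- apply: le_trans (IHb _ pb (le_trans kb1 hl)) _.
  by rewrite ler_expR ler_wpM2r.
Qed.

End mgf.
End average.

(** * The law of the approximate value *)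

Lemma internal_nodes_node a b : internal_nodes (Node a b) =
  [::] :: [seq false :: v | v <- internal_nodes a]
       ++ [seq true :: v | v <- internal_nodes b].
Proof. by rewrite /internal_nodes /= filter_cat !filter_map. Qed.

Lemma uniform_prob_itv (R : realType) (l h : R) : 0 <= l <= h -> h <= 1 ->
  uniform_prob (@ltr01 R) `[l, h[ = (h - l)%:E.
Proof.
move=> /andP[l0 lh] h1; rewrite /uniform_prob integral_uniform_pdf setIidl.
  rewrite (eq_integral (fun=> 1%:E)); last first.
    move=> x; rewrite inE/= in_itv/= => /andP[lx xh]; rewrite /uniform_pdf.
    by rewrite (le_trans l0 lx) (le_trans (ltW xh) h1) subr0 invr1.
  rewrite integral_cst//= mul1e lebesgue_measure_itv/= lte_fin.
  case: ltP => [|hl]; first by rewrite EFinB.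
  by congr EFin; apply/eqP; rewrite eq_sym subr_eq0 eq_le hl.
move=> x /=; rewrite !in_itv/= => /andP[lx xh].
by rewrite (le_trans l0 lx) (le_trans (ltW xh) h1).
Qed.

(** * The operation [oplus] as randomised rounding *)

Section oplus.
Variables (R : realType) (delta : R).
Hypothesis delta01 : 0 < delta < 1 / 2.

Let d0 : 0 < delta. Proof. by case/andP: delta01. Qed.
Let b0 : 0 < 1 + delta. Proof. by rewrite addr_gt0. Qed.

Lemma oplus_posE r x y : 0 < x -> 0 < y -> oplus delta r x y =
  (1 + delta) ^ Num.floor (logb (1 + delta) (x + y) + r).
Proof. by move=> x0 y0; rewrite /oplus (gt_eqF x0). Qed.

Lemma oplus_gt0 r x y : 0 < x -> 0 < y -> 0 < oplus delta r x y.
Proof. by move=> x0 y0; rewrite oplus_posE// exprz_gt0. Qed.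

(** If the logarithm is [k + f] with [k] its floor, the floor of [k + f + r] is [k] or [k + 1]
    according to whether [r < 1 - f]. *)
Lemma oplus_step r x y : 0 < x -> 0 < y -> 0 <= r < 1 ->
  oplus delta r x y = if r < 1 - round_frac delta (x + y)
    then round_down delta (x + y) else (1 + delta) * round_down delta (x + y).
Proof.
move=> x0 y0 /andP[r0 r1]; rewrite oplus_posE//; set L := logb _ _.
have f0 := round_frac_ge0 delta (x + y); have f1 := round_frac_lt1 delta (x + y).
have Lf : L = (round_exp delta (x + y))%:~R + round_frac delta (x + y).
  by rewrite /round_frac subrKC.
case: ltP => rf.
  congr (_ ^ _); apply: floor_def; rewrite Lf intrD.
  by apply/andP; split; lra.
rewrite /round_down -[X in X * _]expr1z -expfzDr ?gt_eqF//.
congr (_ ^ _); apply: floor_def; rewrite Lf !intrD.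
by apply/andP; split; lra.
Qed.

Lemma approx_root_gt0 r t : positive_tree t -> 0 < approx_root delta r t.
Proof.
elim: t r => [x|a IHa b IHb] r pt /=.
  by rewrite ltr0n; exact: positive_tree_root pt.
have [pa pb] := positive_tree_node pt.
by rewrite oplus_gt0 ?IHa ?IHb.
Qed.

Lemma approx_root_supp r t : positive_tree t ->
  (forall u, u \in internal_nodes t -> 0 <= r u < 1) ->
  approx_root delta r t \in supp delta t.
Proof.
elim: t r => [x|a IHa b IHb] r pt hr /=; first by rewrite inE.
have [pa pb] := positive_tree_node pt.
have ha : approx_root delta (fun w => r (false :: w)) a \in supp delta a.
  apply: IHa => // u ua; apply: hr.
  by rewrite internal_nodes_node inE mem_cat map_f ?orbT.
have hb : approx_root delta (fun w => r (true :: w)) b \in supp delta b.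
  apply: IHb => // u ub; apply: hr.
  by rewrite internal_nodes_node inE mem_cat map_f ?orbT.
rewrite oplus_step ?approx_root_gt0//; last first.
  by apply: hr; rewrite internal_nodes_node inE.
rewrite mem_cat; case: ifP => _.
  by rewrite (allpairs_f (fun x y => round_down delta (x + y))).
by rewrite orbC (allpairs_f (fun x y => (1 + delta) * round_down delta (x + y))).
Qed.

(** Rounding is a nondecreasing, hence measurable, function of the logarithm plus the offset;
    positivity avoids the zero case of [oplus]. *)
Lemma measurable_approx_root (d : measure_display) (T : measurableType d)
    (r : address -> T -> R) t : (forall u, measurable_fun setT (r u)) ->
  positive_tree t ->
  measurable_fun setT (fun w => approx_root delta (fun u => r u w) t).
Proof.
elim: t r => [x|a IHa b IHb] r mr pt /=; first exact: measurable_cst.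
have [pa pb] := positive_tree_node pt.
pose za w := approx_root delta (fun u => r (false :: u) w) a.
pose zb w := approx_root delta (fun u => r (true :: u) w) b.
pose G (y : R) := (1 + delta) ^ Num.floor y.
rewrite [X in measurable_fun _ X](_ : _ =
    G \o ((fun w => ln (za w + zb w) * (ln (1 + delta))^-1) \+ r [::])).
  apply: measurableT_comp.
    apply: nondecreasing_measurable => // y1 y2 y12.
    by rewrite /G ler_eXz2l ?ltrDl// le_floor.
  apply: measurable_funD => //; apply: measurable_funM => //.
  apply: measurableT_comp; first exact: measurable_ln.
  apply: measurable_funD.
    by apply: (IHa (fun u => r (false :: u))).
  by apply: (IHb (fun u => r (true :: u))).
by apply/funext => w; rewrite oplus_posE// approx_root_gt0.
Qed.

End oplus.

Section cover.
Variables (R : realType) (d : measure_display) (T : measurableType d).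
Variable P : probability T R.

Lemma le_prob (A B : set T) : measurable A -> measurable B -> A `<=` B ->
  (P A <= P B)%E.
Proof. by move=> mA mB AB; rewrite le_measure ?inE. Qed.

(** The union bound used over pairs of child values, over root values and over nodes. *)
Lemma prob_cover_le (I : eqType) (s : seq I) (F : I -> set T) (A : set T)
    (c : I -> R) : measurable A ->
  (forall i, i \in s -> measurable (F i)) ->
  (forall i, i \in s -> (P (F i) <= (c i)%:E)%E) ->
  (forall w, A w -> exists2 i, i \in s & F i w) ->
  (P A <= (\sum_(i <- s) c i)%:E)%E.
Proof.
elim: s A => [|i s IHs] A mA mF cF AF.
  rewrite big_nil (_ : A = set0) ?measure0//.
  by apply/seteqP; split => // w /AF[].
have mi : measurable (F i) by apply: mF; rewrite inE eqxx.
rewrite big_cons EFinD (_ : A = (A `&` F i) `|` (A `\` F i)); last first.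
  by rewrite setUIDK.
apply: le_trans (measureU2 _ _ _) _.
- exact: measurableI.
- exact: measurableD.
apply: leeD.
  apply: le_trans (cF i _); last by rewrite inE eqxx.
  by apply: le_prob => //; exact: measurableI.
apply: IHs; first exact: measurableD.
- by move=> j js; apply: mF; rewrite inE js orbT.
- by move=> j js; apply: cF; rewrite inE js orbT.
- move=> w [/AF[j]]; rewrite inE => /predU1P[->//|js] Fj _.
  by exists j.
Qed.

End cover.

(** * Domination of the law of the root value by [avg] *)

Section law.
Variables (R : realType) (delta : R).
Hypothesis delta01 : 0 < delta < 1 / 2.
Variables (d : measure_display) (T : measurableType d) (P : probability T R).

Definition in_box (t : addition_tree) (r : address -> T -> R)
    (lo hi : address -> R) : set T :=
  [set w | forall u, u \in internal_nodes t -> lo u <= r u w < hi u].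

Definition box_vol (t : addition_tree) (lo hi : address -> R) : R :=
  \prod_(u <- internal_nodes t) (hi u - lo u).

(* The offsets in t are independent and uniform under the restriction of P to
   E, up to a total mass of c. *)
Definition box_dominated (E : set T) (c : R) t (r : address -> T -> R) : Prop :=
  forall lo hi : address -> R, (forall u, 0 <= lo u <= hi u /\ hi u <= 1) ->
    (P (E `&` in_box t r lo hi) <= (c * box_vol t lo hi)%:E)%E.

(** Glues a root entry and two subtree families, so that a box for [Node a b] is a product of three
    boxes. *)
Definition node_fun (x : R) (f g : address -> R) (u : address) : R :=
  match u with
  | [::] => x
  | false :: v => f v
  | true :: v => g v
  end.

Lemma in_box_node a b r l f g h f' g' :
  in_box (Node a b) r (node_fun l f g) (node_fun h f' g') =
  [set w | l <= r [::] w < h]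
  `&` in_box a (fun u => r (false :: u)) f f'
  `&` in_box b (fun u => r (true :: u)) g g'.
Proof.
apply/seteqP; split => w /=.
  move=> H; split; first split.
  - by apply: (H [::]); rewrite internal_nodes_node inE.
  - move=> u ua; apply: (H (false :: u)).
    by rewrite internal_nodes_node inE mem_cat map_f ?orbT.
  - move=> u ub; apply: (H (true :: u)).
    by rewrite internal_nodes_node inE mem_cat map_f ?orbT.
move=> [[H0 Ha] Hb] u; rewrite internal_nodes_node inE mem_cat.
by case/or3P => [/eqP -> //|/mapP[v va ->]|/mapP[v vb ->]]; [exact: Ha|exact: Hb].
Qed.

Lemma box_vol_node a b l f g h f' g' :
  box_vol (Node a b) (node_fun l f g) (node_fun h f' g') =
  (h - l) * box_vol a f f' * box_vol b g g'.
Proof.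
by rewrite /box_vol internal_nodes_node big_cons big_cat !big_map /= mulrA.
Qed.

Lemma box_vol_ge0 t lo hi : (forall u, 0 <= lo u <= hi u /\ hi u <= 1) ->
  0 <= box_vol t lo hi.
Proof.
by move=> H; apply: prodr_ge0 => u _; rewrite subr_ge0; have [/andP[]] := H u.
Qed.

Lemma measurable_in_box t r lo hi : (forall u, measurable_fun setT (r u)) ->
  measurable (in_box t r lo hi).
Proof.
move=> mr; rewrite /in_box; elim: (internal_nodes t) => [|v s IHs].
  by rewrite (_ : [set w | _] = setT)//; apply/seteqP; split.
rewrite (_ : [set w | _] = (r v @^-1` `[lo v, hi v[%classic) `&`
  [set w | forall u, u \in s -> lo u <= r u w < hi u]).
  by apply: measurableI => //; rewrite -[X in measurable X]setTI; exact: mr.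
apply/seteqP; split => w /=.
  move=> H; split; first by rewrite in_itv/=; apply: H; rewrite inE eqxx.
  by move=> u us; apply: H; rewrite inE us orbT.
by rewrite in_itv/= => -[H0 H] u; rewrite inE => /predU1P[->//|]; exact: H.
Qed.

Local Notation root r w t := (approx_root delta (fun u => r u w) t).

Lemma measurable_approx_root_eq (r : address -> T -> R) t x :
  (forall u, measurable_fun setT (r u)) -> positive_tree t ->
  measurable [set w | root r w t = x].
Proof.
move=> mr pt; rewrite (_ : [set w | _] = (fun w => root r w t) @^-1` [set x])//.
by rewrite -[X in measurable X]setTI; apply: measurable_approx_root.
Qed.

(** Independence enters only through boxes. Since [E] and [c] vary in the induction, [a] can be
    treated under [E] cut by a slab for the root offset and by the event that [b] has value [y]; the
    domination this requires is the induction hypothesis for [b]. *)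
Lemma box_dominated_eq t (r : address -> T -> R) E c x : positive_tree t ->
  (forall u, measurable_fun setT (r u)) -> measurable E -> 0 <= c ->
  (forall w u, E w -> u \in internal_nodes t -> 0 <= r u w < 1) ->
  box_dominated E c t r ->
  (P (E `&` [set w | root r w t = x]) <=
   (c * avg delta t (fun z => (z == x)%:R))%:E)%E.
Proof.
elim: t r E c x => [n|a IHa b IHb] r E c z pt mr mE c0 E01 dom.
  have := dom (fun=> 0) (fun=> 1) (fun u => ltac:(by rewrite lexx ler01)).
  rewrite /box_vol big_nil /=.
  rewrite (_ : in_box _ _ _ _ = setT); last by apply/seteqP; split.
  rewrite setIT mulr1; case: eqP => [->|nx].
    by rewrite (_ : [set w | _] = setT) ?setIT ?mulr1//; apply/seteqP; split.
  by rewrite (_ : [set w | _] = set0) ?setI0 ?measure0 ?mulr0//; apply/seteqP; split.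
have [pa pb] := positive_tree_node pt.
pose ra u := r (false :: u); pose rb u := r (true :: u).
pose Ea x := [set w | root ra w a = x]; pose Eb y := [set w | root rb w b = y].
pose pra x := avg delta a (fun z => (z == x)%:R).
pose prb y := avg delta b (fun z => (z == y)%:R).
pose slab (l h : R) := [set w | l <= r [::] w < h].
have mra u : measurable_fun setT (ra u) by exact: mr.
have mrb u : measurable_fun setT (rb u) by exact: mr.
have mslab l h : measurable (slab l h).
  rewrite (_ : slab l h = r [::] @^-1` `[l, h[%classic).
    by rewrite -[X in measurable X]setTI; exact: mr.
  by apply/seteqP; split => w /=; rewrite in_itv.
have mEa x : measurable (Ea x) by apply: measurable_approx_root_eq.
have mEb y : measurable (Eb y) by apply: measurable_approx_root_eq.
have pra0 x : 0 <= pra x by apply: avg_ge0.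
have prb0 x : 0 <= prb x by apply: avg_ge0.
have split3 l h x y : 0 <= l <= h -> h <= 1 ->
    (P (E `&` slab l h `&` Eb y `&` Ea x) <=
     (c * (h - l) * prb y * pra x)%:E)%E.
  move=> lh h1; have /andP[l0 lh'] := lh.
  have hl0 : 0 <= h - l by rewrite subr_ge0.
  apply: IHa => //.
  - by repeat (apply: measurableI => //).
  - by rewrite !mulr_ge0.
  - move=> w u [[Ew _] _] ua; apply: E01 => //.
    by rewrite internal_nodes_node inE mem_cat map_f ?orbT.
  move=> f f' hf.
  have -> : c * (h - l) * prb y * box_vol a f f' =
     c * (h - l) * box_vol a f f' * prb y by ring.
  (* The box of [a] now joins [E]; what remains to bound are boxes for the whole node. *)
  rewrite (setIAC _ (Eb y)); apply: IHb => //.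
  - by repeat (apply: measurableI => //); apply: measurable_in_box.
  - by rewrite !mulr_ge0// box_vol_ge0.
  - move=> w u [[Ew _] _] ub; apply: E01 => //.
    by rewrite internal_nodes_node inE mem_cat map_f ?orbT.
  move=> g g' hg; rewrite -!setIA.
  have := dom (node_fun l f g) (node_fun h f' g').
  rewrite in_box_node box_vol_node -!setIA -!mulrA; apply.
  by case=> [//|[] u]; [exact: hg|exact: hf].
have prod0 x y : 0 <= c * prb y * pra x by rewrite !mulr_ge0.
(* Without [undup], repeated values would be counted several times. *)
pose s := [seq (x, y) | x <- undup (supp delta a), y <- undup (supp delta b)].
have -> : c * avg delta (Node a b) (fun z' => (z' == z)%:R) =
   \sum_(p <- s) c * prb p.2 * pra p.1 *
     step delta (p.1 + p.2) (fun z' => (z' == z)%:R).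
  rewrite /s big_allpairs /= avg_point big_distrr /=; apply: eq_bigr => x _.
  rewrite avg_point -/(pra x) mulr_suml mulr_sumr; apply: eq_bigr => y _.
  by rewrite -/(prb y); ring.
pose Et := [set w | root r w (Node a b) = z].
have mEt : measurable Et by exact: measurable_approx_root_eq.
apply: (@prob_cover_le _ _ _ P _ s (fun p => E `&` Eb p.2 `&` Ea p.1 `&` Et)).
- exact: measurableI.
- by move=> p _; repeat (apply: measurableI => //).
- move=> _ /allpairsP[[x y] [xa yb ->]] /=.
  rewrite mem_undup in xa; rewrite mem_undup in yb.
  have x0 := supp_gt0 delta01 pa xa; have y0 := supp_gt0 delta01 pb yb.
  have f0 := round_frac_ge0 delta (x + y).
  have f1 := round_frac_lt1 delta (x + y).
  have u0 := round_down_gt0 delta01 (x + y).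
  set F := (X in P X).
  have mF : measurable F.
    by repeat (apply: measurableI => //).
  have FE w : F w -> [/\ E w, Eb y w, Ea x w, 0 <= r [::] w < 1 &
     z = if r [::] w < 1 - round_frac delta (x + y)
       then round_down delta (x + y) else (1 + delta) * round_down delta (x + y)].
    move=> [[[Ew Ebw] Eaw] Ez].
    have r01 : 0 <= r [::] w < 1.
      by apply: E01 => //; rewrite internal_nodes_node inE.
    split => //; rewrite -oplus_step//; move: Ez; rewrite /Et /= => <-.
    by rewrite (_ : approx_root _ _ a = x)// (_ : approx_root _ _ b = y).
  have ud : round_down delta (x + y) < (1 + delta) * round_down delta (x + y).
    by rewrite ltr_pMl// ltrDl; case/andP: delta01.
  (* For fixed child values, the lower outcome confines the root offset to [0, 1 - f), the upper one
     to [1 - f, 1), and any other [z] is impossible. *)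
  have [zl|zl] := eqVneq (round_down delta (x + y)) z.
    rewrite /step zl eqxx -zl gt_eqF// mulr1 mulr0 addr0.
    apply: (@le_trans _ _ (P (E `&` slab 0 (1 - round_frac delta (x + y))
        `&` Eb y `&` Ea x))).
      apply: le_prob => //; first by repeat (apply: measurableI => //).
      move=> w /FE[Ew Ebw Eaw /andP[r0 r1] ez]; do 3 split => //.
      rewrite /slab /= r0 /=; move: ez; case: ifP => // _ ez.
      by move: ud; rewrite -ez zl ltxx.
    apply: le_trans (split3 0 _ _ _ _ _) _; last 2 [lra].
      by rewrite lexx /= subr_ge0 ltW.
    by rewrite lee_fin subr0; lra.
  have [zh|zh] := eqVneq ((1 + delta) * round_down delta (x + y)) z.
    rewrite /step (negbTE zl) zh eqxx mulr1 mulr0 add0r.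
    apply: (@le_trans _ _ (P (E `&` slab (1 - round_frac delta (x + y)) 1
        `&` Eb y `&` Ea x))).
      apply: le_prob => //; first by repeat (apply: measurableI => //).
      move=> w /FE[Ew Ebw Eaw /andP[r0 r1] ez]; do 3 split => //.
      rewrite /slab /= r1 andbT leNgt; move: ez; case: ifP => // _ ez.
      by rewrite ez eqxx in zl.
    apply: le_trans (split3 _ 1 _ _ _ _) _ => //.
      by apply/andP; split; lra.
    by rewrite lee_fin; lra.
  rewrite (_ : F = set0).
    by rewrite measure0 lee_fin mulr_ge0 ?prod0//; apply: step_ge0.
  apply/seteqP; split => // w /FE[_ _ _ _]; case: ifP => _ ez.
    by rewrite ez eqxx in zl.
  by rewrite ez eqxx in zh.
- move=> w [Ew Ez]; exists (root ra w a, root rb w b) => //.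
  apply: allpairs_f; rewrite mem_undup; apply: approx_root_supp => // u ua;
    by apply: E01 => //; rewrite internal_nodes_node inE mem_cat map_f ?orbT.
Qed.

Lemma box_dominated_le t (r : address -> T -> R) E c (S : pred R) (A : set T) :
  positive_tree t ->
  (forall u, measurable_fun setT (r u)) -> measurable E -> 0 <= c ->
  (forall w u, E w -> u \in internal_nodes t -> 0 <= r u w < 1) ->
  box_dominated E c t r ->
  measurable A -> A `<=` E -> (forall w, A w -> S (root r w t)) ->
  (P A <= (c * avg delta t (fun z => (S z)%:R))%:E)%E.
Proof.
move=> pt mr mE c0 E01 dom mA AE AS.
rewrite avg_point mulr_sumr.
apply: (@prob_cover_le _ _ _ P _ _
   (fun x => A `&` [set w | root r w t = x])) => //.
- by move=> x _; apply: measurableI => //; exact: measurable_approx_root_eq.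
- move=> x _; have [Sx|Sx] := boolP (S x); last first.
    rewrite (_ : _ `&` _ = set0) ?measure0 ?mul0r ?mulr0//.
    by apply/seteqP; split => // w [/AS + /= e]; rewrite e (negbTE Sx).
  rewrite mul1r; apply: le_trans (box_dominated_eq _ pt mr mE c0 E01 dom).
  apply: le_prob.
  - by apply: measurableI => //; exact: measurable_approx_root_eq.
  - by apply: measurableI => //; exact: measurable_approx_root_eq.
  - by apply: setSI.
- move=> w Aw; exists (root r w t) => //.
  by rewrite mem_undup approx_root_supp// => u; apply: E01; exact: AE.
Qed.

End law.

(** * Tail bound and union bound *)

Lemma nodes_cat t v u : v \in nodes t -> u \in nodes (subtree t v) ->
  v ++ u \in nodes t.
Proof.
elim: t v => [x|a IHa b IHb] v.
  by rewrite inE => /eqP ->.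
rewrite [nodes (Node _ _)]/= inE mem_cat.
case/or3P => [/eqP -> //|/mapP[w wa ->]|/mapP[w wb ->]] h.
- by rewrite /= inE mem_cat map_f ?orbT// IHa.
- by rewrite /= inE mem_cat [X in [|| _, _ | X]]map_f ?orbT// IHb.
Qed.

Lemma internal_nodes_cat t v u : v \in nodes t ->
  u \in internal_nodes (subtree t v) -> v ++ u \in internal_nodes t.
Proof.
move=> vt; rewrite !mem_filter subtree_cat => /andP[-> ut].
exact: nodes_cat.
Qed.

Lemma size_nodes_subtree t v : (size (nodes (subtree t v)) <= size (nodes t))%N.
Proof.
elim: t v => [x|a IHa b IHb] [|c v] //=.
rewrite size_cat !size_map; apply: leqW; case: c.
- exact: leq_trans (IHb v) (leq_addl _ _).
- exact: leq_trans (IHa v) (leq_addr _ _).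
Qed.

Lemma uniq_nodes t : uniq (nodes t).
Proof.
elim: t => [x|a IHa b IHb] //=.
have inj c : injective (cons c : address -> address) by move=> ? ? [].
rewrite mem_cat negb_or cat_uniq !map_inj_uniq// IHa IHb andbT -andbA.
apply/and3P; split.
- by apply/mapP => -[].
- by apply/mapP => -[].
- by apply/hasPn => _ /mapP[w _ ->]; apply/mapP => -[].
Qed.

Lemma positive_tree_subtree t v : positive_tree t -> v \in nodes t ->
  positive_tree (subtree t v).
Proof.
move=> pt vt u hu; have := pt _ (nodes_cat vt hu).
by rewrite /exact_value subtree_cat.
Qed.

Section tail.
Variables (R : realType) (delta eps : R).
Hypotheses (delta01 : 0 < delta < 1 / 2) (eps01 : 0 < eps < 1 / 8).

(* The upper cutoff 4 y is never exceeded for the first time: rounding costs a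
   factor at most 1 + delta. *)
Definition deviates (y z : R) : bool :=
  ((1 + eps) * y < z <= 4 * y) || ((1 + eps) * z < y).

(** Markov's inequality for [weight], with [lam = Lam / 2] for upper deviations and
    [lam = - Lam / 2] for lower ones. A leaf is exact. *)
Lemma avg_deviates_le t : positive_tree t ->
  (1 + 2 * delta) ^+ rank t <= 1 + eps / 8 ->
  avg delta t (fun z => (deviates (exact_root t)%:R z)%:R) <=
  2 * expR (- (eps ^+ 2 / (128 * 128 * delta))).
Proof.
move=> pt hq; have /andP[d0 dlt] := delta01; have /andP[e0 elt] := eps01.
have Y0 : 0 < (exact_root t)%:R :> R by rewrite ltr0n positive_tree_root.
have [lt|nlt] := boolP (is_leaf t).
  case: t lt pt hq Y0 => [x|//] _ pt _ /= Y0.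
  rewrite /deviates (_ : _ || _ = false) ?mulr_ge0 ?expR_ge0//.
  apply/negbTE; rewrite negb_or negb_and -!leNgt.
  by apply/andP; split; [apply/orP; left|]; rewrite ler_peMl ?lerDl ?ltW.
set Y : R := (exact_root t)%:R in Y0 *.
(* This [eta] makes [kap Y^2 = K eps / 128], small against the gain of order [K eps] from a
   deviation; the condition on the cutoff [4 Y] becomes [384 eta <= 1]. *)
pose eta : R := eps / (64 * 64); pose K : R := eta / delta.
pose Lam : R := eta / (delta * Y).
have K0 : 0 < K by rewrite !divr_gt0.
have Lam0 : 0 < Lam by rewrite !divr_gt0// mulr_gt0.
have LY : Lam * Y = K by rewrite /Lam /K; field; rewrite !gt_eqF.
have LamB : 96 * delta * Lam * (4 * Y) <= 1.
  rewrite (_ : _ * _ = 384 * eta); last first.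
    by rewrite /Lam; field; rewrite !gt_eqF.
  by rewrite /eta; lra.
have kapY : 32 * delta * Lam ^+ 2 * Y ^+ 2 = K * eps / 128.
  by rewrite /Lam /K /eta; field; rewrite !gt_eqF.
have kap0 : 0 <= 32 * delta * Lam ^+ 2.
  by rewrite mulr_ge0 ?sqr_ge0// mulr_ge0// ltW.
have q1 : 1 <= (1 + 2 * delta) ^+ rank t by rewrite exprn_ege1//; lra.
set q := (1 + 2 * delta) ^+ rank t in hq q1 *.
have goalE : eps ^+ 2 / (128 * 128 * delta) = K * eps / 4.
  by rewrite /K /eta; field; rewrite gt_eqF.
have Y4 : 0 <= 4 * Y by rewrite mulr_ge0// ltW.
have L20 : 0 <= Lam / 2 by rewrite divr_ge0// ltW.
(* Half of [Lam] leaves room for the bias factor [q <= 2]. *)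
have mgf lam : `|lam| = Lam / 2 ->
    avg delta t (weight delta Lam (4 * Y) false lam) <=
    expR (lam * Y + K / 2 * (q - 1)).
  move=> hl; have := @avg_weight_le R delta delta01 Lam (4 * Y) Lam0 LamB t lam pt.
  rewrite -/q (negbTE nlt) => /(_ _) H; apply: le_trans (H _) _.
    rewrite hl -[leRHS]mulr1 -mulrA ler_pM2l//; lra.
  rewrite ler_expR hl -LY mulrDl lerD2l le_eqVlt.
  by apply/orP; left; apply/eqP; field.
have half (S : pred R) (lam a : R) : `|lam| = Lam / 2 ->
    (forall z, z \in supp delta t -> S z ->
       z <= 4 * Y /\ a <= lam * z - 32 * delta * Lam ^+ 2 * z ^+ 2) ->
    - a + (lam * Y + K / 2 * (q - 1)) <= - (K * eps / 4) ->
    avg delta t (fun z => (S z)%:R) <= expR (- (K * eps / 4)).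
  move=> hl hS ha.
  apply: (@le_trans _ _ (avg delta t
     (fun z => expR (- a) * weight delta Lam (4 * Y) false lam z))).
    apply: ler_avg => // z zt; have [Sz|nSz] := boolP (S z); last first.
      by rewrite mulr_ge0 ?expR_ge0// weight_ge0.
    have [zB az] := hS z zt Sz; rewrite /weight zB /gexp -expRD.
    apply: le_trans (expR_ge1Dx _); rewrite lerDl; lra.
  rewrite avgZ//.
  apply: (@le_trans _ _ (expR (- a) * expR (lam * Y + K / 2 * (q - 1)))).
    by rewrite ler_wpM2l ?expR_ge0// mgf.
  by rewrite -expRD ler_expR.
pose S1 z := ((1 + eps) * Y < z <= 4 * Y); pose S2 z := ((1 + eps) * z < Y).
apply: (@le_trans _ _ (avg delta t (fun z => (S1 z)%:R + (S2 z)%:R))).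
  apply: ler_avg => // z _; rewrite /deviates -/(S1 z) -/(S2 z).
  by case: (S1 z); case: (S2 z); rewrite ?addr0 ?add0r ?lerDl.
rewrite avgD// goalE mulr_natl mulr2n.
have q8 : K * (q - 1) <= K * (eps / 8) by rewrite ler_pM2l//; lra.
have Ke : 0 < K * eps by rewrite mulr_gt0.
apply: lerD.
(* The cutoff bounds the discount by [16 kap Y^2 = K eps / 8]; the bias adds [K eps / 16], so the
   exponent is at most [- 5 K eps / 16]. *)
- apply: (half S1 (Lam / 2) (K / 2 * (1 + eps) - K * eps / 8)).
  + by rewrite ger0_norm.
  + move=> z _ /andP[z1 z4]; split => //.
    have z0 : 0 <= z by apply: le_trans (ltW z1); rewrite mulr_ge0 ?ltW//; lra.
    have h1 : Lam / 2 * ((1 + eps) * Y) <= Lam / 2 * z.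
      by rewrite ler_wpM2l// ltW.
    have h2 : 32 * delta * Lam ^+ 2 * z ^+ 2 <= 32 * delta * Lam ^+ 2 * (4 * Y) ^+ 2.
      by rewrite ler_wpM2l// lerXn2r.
    have e1 : Lam / 2 * ((1 + eps) * Y) = K / 2 * (1 + eps) by rewrite -LY; ring.
    have e2 : 32 * delta * Lam ^+ 2 * (4 * Y) ^+ 2 = K * eps / 8.
      have -> : 32 * delta * Lam ^+ 2 * (4 * Y) ^+ 2 =
        16 * (32 * delta * Lam ^+ 2 * Y ^+ 2) by ring.
      by rewrite kapY; field.
    lra.
  + have -> : Lam / 2 * Y = K / 2 by rewrite -LY; ring.
    lra.
(* For [eps <= 1 / 3] one has [1 / (1 + eps) <= 1 - 3 eps / 4]; the exponent is at most
   [- 39 K eps / 128]. *)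
- apply: (half S2 (- (Lam / 2)) (- (K / 2 * (1 - 3 / 4 * eps)) - K * eps / 128)).
  + by rewrite normrN ger0_norm.
  + move=> z zt; rewrite /S2 => z1; have z0 := supp_gt0 delta01 pt zt.
    have zY : z <= Y by nra.
    have zY' : z <= (1 - 3 / 4 * eps) * Y.
      rewrite -(@ler_pM2l _ (1 + eps)); last by lra.
      apply: le_trans (ltW z1) _; rewrite mulrA ler_peMl ?(ltW Y0)//; nra.
    split; first by lra.
    have h1 : Lam / 2 * z <= Lam / 2 * ((1 - 3 / 4 * eps) * Y).
      by rewrite ler_wpM2l.
    have h2 : 32 * delta * Lam ^+ 2 * z ^+ 2 <= 32 * delta * Lam ^+ 2 * Y ^+ 2.
      by rewrite ler_wpM2l// lerXn2r ?nnegrE ?(ltW z0) ?(ltW Y0).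
    have e1 : Lam / 2 * ((1 - 3 / 4 * eps) * Y) = K / 2 * (1 - 3 / 4 * eps).
      by rewrite -LY; ring.
    rewrite kapY in h2; lra.
  + have -> : - (Lam / 2) * Y = - (K / 2) by rewrite -LY; ring.
    lra.
Qed.

(** By induction the children are within a factor 9/8 from above, and rounding costs at most 3/2, so
    the node stays below the cutoff 4; not deviating then sharpens the bound to [1 + eps]. *)
Lemma approx_value_upper (r : address -> R) t v : positive_tree t ->
  (forall u, u \in internal_nodes t -> 0 <= r u < 1) ->
  (forall u, u \in nodes t ->
     ~~ deviates (exact_value t u)%:R (approx_value delta r t u)) ->
  v \in nodes t ->
  approx_value delta r t v <= (1 + eps) * (exact_value t v)%:R.
Proof.
have /andP[d0 dlt] := delta01; have /andP[e0 elt] := eps01.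
elim: t r v => [x|a IHa b IHb] r v pt hr hdev.
  by rewrite inE => /eqP -> /=; rewrite ler_peMl// lerDl ltW.
have [pa pb] := positive_tree_node pt.
have Ia u : u \in nodes a -> approx_value delta (fun w => r (false :: w)) a u
    <= (1 + eps) * (exact_value a u)%:R.
  apply: IHa => // w wa.
    by apply: hr; rewrite internal_nodes_node inE mem_cat map_f ?orbT.
  by apply: (hdev (false :: w)); rewrite /= inE mem_cat map_f ?orbT.
have Ib u : u \in nodes b -> approx_value delta (fun w => r (true :: w)) b u
    <= (1 + eps) * (exact_value b u)%:R.
  apply: IHb => // w wb.
    by apply: hr; rewrite internal_nodes_node inE mem_cat map_f ?orbT.
  apply: (hdev (true :: w)).
  by rewrite /= inE mem_cat [X in [|| _, _ | X]]map_f ?orbT.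
rewrite /= inE mem_cat.
case/or3P => [/eqP ->|/mapP[w wa ->]|/mapP[w wb ->]]; [|exact: Ia|exact: Ib].
have root t' : [::] \in nodes t' by case: t' => *; rewrite inE.
have za := Ia [::] (root a); have zb := Ib [::] (root b).
have := hdev [::] (root (Node a b)); rewrite /deviates negb_or negb_and -leNgt.
move=> /andP[/orP[//|] + _]; rewrite -ltNge => z4.
move: za zb z4; rewrite /approx_value /exact_value.
have subE t' : subtree t' [::] = t' by case: t'.
rewrite !subE.
rewrite /=.
set za := approx_root _ _ a; set zb := approx_root _ _ b => ha hb.
have za0 : 0 < za by apply: approx_root_gt0.
have zb0 : 0 < zb by apply: approx_root_gt0.
have s0 : 0 < za + zb by rewrite addr_gt0.
rewrite oplus_step//; last by apply: hr; rewrite internal_nodes_node inE.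
have us := round_down_le delta01 s0; have u0 := round_down_gt0 delta01 (za + zb).
rewrite natrD; set A := (exact_root a)%:R in ha *; set B := (exact_root b)%:R in hb *.
have A0 : 0 <= A by rewrite ler0n.
have B0 : 0 <= B by rewrite ler0n.
set ifu := (if _ then _ else _) => z4.
have : ifu <= (1 + delta) * (za + zb) by rewrite /ifu; case: ifP => _; nra.
have : za <= 9 / 8 * A by nra.
have : zb <= 9 / 8 * B by nra.
have : (1 + delta) * (za + zb) <= 3 / 2 * (za + zb) by rewrite ler_wpM2r// ?ltW//; lra.
lra.
Qed.

End tail.

(** * Box domination from independence and uniformity *)

Section tree_probability.
Variables (R : realType) (d : measure_display) (T : measurableType d).
Variables (P : probability T R) (t : addition_tree) (r : address -> {RV P >-> R}).
Hypothesis unif : forall v, v \in internal_nodes t -> uniform01 (r v).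
Hypothesis indep : mutually_independent [set` internal_nodes t] r.

Lemma prob_in_box v lo hi : v \in nodes t ->
  (forall u, 0 <= lo u <= hi u /\ hi u <= 1) ->
  P (in_box (subtree t v) (fun u => r (v ++ u) : T -> R) lo hi) =
  (box_vol (subtree t v) lo hi)%:E.
Proof.
move=> vt lohi.
pose s := [seq v ++ u | u <- internal_nodes (subtree t v)].
(* [drop] recovers the address inside the subtree from the address in [t]. *)
pose A (w : address) : set R :=
  `[lo (drop (size v) w), hi (drop (size v) w)[%classic.
have us : uniq s.
  rewrite map_inj_uniq ?filter_uniq ?uniq_nodes// => u1 u2 /eqP.
  by rewrite eqseq_cat// eqxx => /eqP.
have := indep (J := [fset w in s]%fset) (A := A).
have -> : in_box (subtree t v) (fun u => r (v ++ u) : T -> R) lo hi =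
    \bigcap_(w in [set` [fset w in s]%fset]) (r w @^-1` A w).
  apply/seteqP; split => w /=.
    move=> H i /=; rewrite !inE => /mapP[u uv ->].
    by rewrite /A /= drop_size_cat// in_itv/= H.
  move=> H u uv; have := H (v ++ u); rewrite /= !inE map_f// => /(_ isT).
  by rewrite /A /= drop_size_cat// in_itv.
move=> ->.
- rewrite (perm_big s) /=; last first.
    by apply: uniq_perm => [||w]; rewrite ?fset_uniq// !inE.
  rewrite big_map /box_vol -prodEFin [LHS]big_seq [RHS]big_seq.
  apply: eq_bigr => u uv.
  have [lh h1] := lohi u.
  rewrite -(uniform_prob_itv lh h1) -(unif (internal_nodes_cat vt uv))//.
  by rewrite /A drop_size_cat.
- by move=> w /=; rewrite !inE => /mapP[u uv ->]; exact: internal_nodes_cat.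
- by move=> w _; exact: measurable_itv.
Qed.

(** Uniform offsets lie in [0, 1) only almost surely; restriction to the unit box makes this hold
    pointwise. *)
Lemma box_dominated_subtree v : v \in nodes t ->
  box_dominated P (in_box (subtree t v) (fun u => r (v ++ u) : T -> R)
     (fun=> 0) (fun=> 1)) 1 (subtree t v) (fun u => r (v ++ u) : T -> R).
Proof.
move=> vt lo hi lohi; rewrite mul1r -prob_in_box//.
apply: le_prob; last exact: subIsetr.
  by apply: measurableI; apply: measurable_in_box => u; exact: measurable_funP.
by apply: measurable_in_box => u; exact: measurable_funP.
Qed.

End tree_probability.

Lemma measurable_exists_seq (d : measure_display) (T : measurableType d)
    (I : eqType) (s : seq I) (F : I -> set T) :
  (forall i, i \in s -> measurable (F i)) ->
  measurable [set w | exists i, i \in s /\ F i w].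
Proof.
elim: s => [|i s IHs] mF.
  by rewrite (_ : [set w | _] = set0)//; apply/seteqP; split => // w [j []].
rewrite (_ : [set w | _] = F i `|` [set w | exists j, j \in s /\ F j w]).
  apply: measurableU; first by apply: mF; rewrite inE eqxx.
  by apply: IHs => j js; apply: mF; rewrite inE js orbT.
apply/seteqP; split => w /=.
  by move=> [j []]; rewrite inE => /predU1P[->|js] Fj; [left|right; exists j].
move=> [Fi|[j [js Fj]]]; first by exists i; rewrite inE eqxx.
by exists j; rewrite inE js orbT.
Qed.

Lemma ratio_gt_deviates (R : realType) (eps y z : R) : 0 < y -> 0 < z ->
  (1 + eps < Num.max (z / y) (y / z)) = ((1 + eps) * y < z) || ((1 + eps) * z < y).
Proof. by move=> y0 z0; rewrite lt_max !ltr_pdivlMr. Qed.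

(** * Numerical consequences of the bound on [delta] *)

Section numeric.
Variables (R : realType) (n : nat) (delta eps : R).
Hypotheses (n2 : (2 <= n)%N) (delta0 : 0 < delta) (eps01 : 0 < eps < 1 / 8).
Hypothesis small : delta < eps ^+ 2 / (64 * 64 * 64 * logb 2 n%:R ^+ 6).

Let ell : R := logb 2 n%:R.

Let ln2_gt0 : 0 < ln 2 :> R. Proof. by rewrite ln_gt0// ltr1n. Qed.

Let ell_ln : ell * ln 2 = ln n%:R :> R.
Proof. by rewrite /ell /logb divfK// gt_eqF. Qed.

Lemma logb2_ge1 : 1 <= ell.
Proof.
rewrite /ell /logb ler_pdivlMr// mul1r ler_ln ?posrE ?ltr0n ?ler_nat//.
exact: leq_trans n2.
Qed.

Let smallE : delta * (64 * 64 * 64 * ell ^+ 6) < eps ^+ 2.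
Proof.
have e1 := logb2_ge1.
by rewrite -ltr_pdivlMr// mulr_gt0// exprn_gt0// (lt_le_trans _ e1).
Qed.

(** Here [k <= ell], so [2 delta k <= eps / 32], and the power is at most [expR (2 delta k)]. *)
Lemma rank_factor_le (k : nat) : (2 ^ k <= n)%N ->
  (1 + 2 * delta) ^+ k <= 1 + eps / 8.
Proof.
move=> kn; have /andP[e0 elt] := eps01; have e1 := logb2_ge1.
have kell : k%:R <= ell.
  rewrite -(ler_pM2r ln2_gt0) ell_ln mulr_natl -lnXn ?ltr0n//.
  rewrite ler_ln ?posrE ?exprn_gt0 ?ltr0n//; last exact: leq_trans n2.
  by rewrite -natrX ler_nat.
have dk : delta * k%:R * (64 * 64 * 64) <= eps ^+ 2.
  apply: le_trans (ltW smallE).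
  have -> : delta * (64 * 64 * 64 * ell ^+ 6) = delta * ell ^+ 6 * (64 * 64 * 64) by ring.
  rewrite ler_wpM2r// ler_wpM2l ?(ltW delta0)//; apply: (le_trans kell).
  by rewrite -[leLHS]expr1 ler_weXn2l.
have dk0 : 0 <= delta * k%:R by rewrite mulr_ge0// ltW.
apply: (@le_trans _ _ (expR (2 * delta * k%:R))).
  rewrite expRM_natr lerXn2r ?nnegrE ?expR_ge0 ?expR_ge1Dx//.
  by rewrite addr_ge0// mulr_ge0// ltW.
have d2 : 2 * delta * k%:R <= eps / 32 by nra.
apply: le_trans (expR_le_quad _) _; first by lra.
nra.
Qed.

Lemma union_bound_le :
  n%:R * (2 * expR (- (eps ^+ 2 / (128 * 128 * delta)))) <= n%:R `^ (- ell) :> R.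
Proof.
have e1 := logb2_ge1; have n0 : 0 < n%:R :> R by rewrite ltr0n; exact: leq_trans n2.
rewrite /powR gt_eqF//.
have lnl : ln n%:R <= ell.
  rewrite -ell_ln ler_piMr//; first exact: le_trans e1.
  by have := @le_ln1Dx R 1 ltac:(lra); rewrite (_ : 1 + 1 = 2).
have h2 : 2 <= expR 1 :> R by have := @expR_ge1Dx R 1; rewrite (_ : 1 + 1 = 2).
(* As 64^3 is 16 times 128^2, a factor 16 remains; it absorbs [ln n + 1 + ell ln n <= 3 ell^2]. *)
have he : 16 * ell ^+ 6 <= eps ^+ 2 / (128 * 128 * delta).
  rewrite ler_pdivlMr ?mulr_gt0//; apply: le_trans (ltW smallE).
  by rewrite le_eqVlt; apply/orP; left; apply/eqP; ring.
rewrite -[X in X * (2 * _)](lnK (x := n%:R)) ?posrE//.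
apply: (@le_trans _ _ (expR (ln n%:R) * (expR 1 * expR (- (16 * ell ^+ 6))))).
  rewrite ler_wpM2l ?expR_ge0// ler_pM ?expR_ge0//.
  by rewrite ler_expR lerN2.
rewrite -!expRD ler_expR.
have l2 : ell <= ell ^+ 2 by rewrite -[leLHS]expr1 ler_weXn2l.
have l6 : ell ^+ 2 <= ell ^+ 6 by rewrite ler_weXn2l.
have : ell * ln n%:R <= ell ^+ 2 by rewrite expr2 ler_wpM2l// (le_trans _ e1).
lra.
Qed.

End numeric.

(** * Union bound over the nodes, on the event that all offsets lie in [0, 1) *)

Unset Implicit Arguments.
Set Strict Implicit.
Set Printing Implicit Defensive.

Theorem theorem4 (R : realType) :
  exists C : R, 0 < C /\
  exists n0 : nat,
  forall (n : nat) (t : addition_tree) (delta : R)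
         (d : measure_display) (T : measurableType d) (P : probability T R)
         (r : address -> {RV P >-> R}),
    size (nodes t) = n ->
    0 < delta < 1 / 2 ->
    (forall v, v \in nodes t -> (0 < exact_value t v)%N) ->
    (forall v, v \in internal_nodes t -> uniform01 (r v)) ->
    mutually_independent [set` internal_nodes t] r ->
  forall eps : R,
    0 < eps < 1 / 8 ->
    (n0 <= n)%N ->
    delta < eps ^+ 2 / (C * logb 2 n%:R ^+ 6) ->
    (P [set w | exists v, v \in nodes t /\
          let y : R := (exact_value t v)%:R in
          let z : R := approx_value delta (fun u => r u w) t v in
          (1 + eps < Num.max (z / y) (y / z))%R]
      <= (n%:R `^ (- logb 2 n%:R))%:E)%E.
Proof.
exists (64 * 64 * 64); split; first by rewrite !mulr_gt0.
(* From [n >= 2] on, the logarithm is at least 1 and its powers increase with the exponent. *)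
exists 2%N => n t delta d T P r nE delta01 pt unif indep eps eps01 n2 small.
have /andP[d0 dlt] := delta01; have /andP[e0 elt] := eps01.
set Bad := [set w | _].
pose z v (w : T) := approx_value delta (fun u => r u w) t v.
pose y v : R := (exact_value t v)%:R.
have y0 v : v \in nodes t -> 0 < y v by move=> /pt; rewrite ltr0n.
have psub v : v \in nodes t -> positive_tree (subtree t v).
  exact: positive_tree_subtree.
have z0 v w : v \in nodes t -> 0 < z v w.
  by move=> vt; apply: approx_root_gt0 => //; exact: psub.
have mr u : measurable_fun setT (r u : T -> R) by exact: measurable_funP.
have mz v : v \in nodes t -> measurable_fun setT (z v).
  move=> vt; apply: (measurable_approx_root delta01
    (r := fun u => r (v ++ u) : T -> R)) => //; exact: psub.
have mdev v : v \in nodes t -> measurable [set w | deviates eps (y v) (z v w)].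
  move=> vt; rewrite (_ : [set w | _] = z v @^-1`
     (`](1 + eps) * y v, 4 * y v]%classic `|` `]-oo, y v / (1 + eps)[%classic)).
    rewrite -[X in measurable X]setTI; apply: mz => //.
    by apply: measurableU; exact: measurable_itv.
  have e1 : 0 < 1 + eps by rewrite addr_gt0.
  apply/seteqP; split => w /=; rewrite /deviates !in_itv/= ltr_pdivlMr// [z v w * _]mulrC.
    by case/orP; [left|right].
  by case=> ->; rewrite ?orbT.
have mBad : measurable Bad.
  apply: measurable_exists_seq => v vt.
  rewrite (_ : (fun w => _) = z v @^-1`
     (`](1 + eps) * y v, +oo[%classic `|` `]-oo, y v / (1 + eps)[%classic)).
    rewrite -[X in measurable X]setTI; apply: mz => //.
    by apply: measurableU; exact: measurable_itv.
  have e1 : 0 < 1 + eps by rewrite addr_gt0.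
  apply/funext => w; apply/propext; rewrite /= ratio_gt_deviates ?y0 ?z0//.
  rewrite !in_itv/= andbT ltr_pdivlMr// [z v w * _]mulrC.
  by split=> [/orP[]|[]] h; [left|right|apply/orP; left|apply/orP; right].
have root_in : [::] \in nodes t by case: (t) => *; rewrite inE.
have subt : subtree t [::] = t by case: (t).
pose Good := in_box t (fun u => r u : T -> R) (fun=> 0) (fun=> 1).
have mGood : measurable Good by exact: measurable_in_box.
pose lo (_ : address) : R := 0; pose hi (_ : address) : R := 1.
have bnd01 u : 0 <= lo u <= hi u /\ hi u <= 1 by rewrite lexx ler01.
have PGood : P Good = 1%E.
  have := prob_in_box unif indep root_in bnd01; rewrite subt => ->.
  by rewrite /box_vol big1// => u _; rewrite subr0.
have PGoodC : P (~` Good) = 0%E by rewrite probability_setC// PGood subee.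
rewrite -(setUIDK Bad Good); apply: le_trans (measureU2 _ _ _) _.
- exact: measurableI.
- exact: measurableD.
rewrite [X in (_ + X)%E](_ : _ = 0%E) ?adde0; last first.
  by apply: subset_measure0 PGoodC => //; [exact: measurableD|exact: measurableC].
have sumE : \sum_(v <- nodes t) 2 * expR (- (eps ^+ 2 / (128 * 128 * delta))) =
    n%:R * (2 * expR (- (eps ^+ 2 / (128 * 128 * delta)))).
  by rewrite big_const_seq count_predT nE iter_addr_0 [RHS]mulr_natl.
apply: (@le_trans _ _ (n%:R * (2 * expR (- (eps ^+ 2 / (128 * 128 * delta)))))%:E);
  last by rewrite lee_fin; exact: union_bound_le.
rewrite -sumE; apply: (@prob_cover_le _ _ _ P _ (nodes t)
  (fun v => Good `&` [set w | deviates eps (y v) (z v w)])).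
- exact: measurableI.
- by move=> v vt; apply: measurableI => //; exact: mdev.
- move=> v vt.
  apply: (@le_trans _ _ (1 * avg delta (subtree t v)
     (fun x => (deviates eps (y v) x)%:R))%:E).
    apply: (box_dominated_le delta01 (psub v vt) _ _ _ _
      (box_dominated_subtree unif indep vt)).
    + by move=> u; exact: mr.
    + by apply: measurable_in_box => u; exact: mr.
    + by [].
    + by move=> w u; apply.
    + by apply: measurableI => //; exact: mdev.
    + move=> w [G _] u uv; apply: G; exact: internal_nodes_cat.
    + by move=> w [].
  rewrite mul1r lee_fin; apply: avg_deviates_le => //; first exact: psub.
  apply: rank_factor_le n2 d0 eps01 small _ _.
  rewrite -nE; exact: leq_trans (expn_rank_le _) (size_nodes_subtree _ _).
- move=> w [[v [vt]]] /=; rewrite -/(y v) -/(z v w) ratio_gt_deviates ?y0 ?z0//.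
  move=> hv Gw.
  (* If no node deviates in the sense with cutoff, [approx_value_upper] excludes an upper deviation
     at [v]; the remaining lower one is itself covered by [deviates]. *)
  have [/hasP[u ut du]|/hasPn nodev] :=
    boolP (has (fun u => deviates eps (y u) (z u w)) (nodes t)).
    by exists u.
  exists v => //; split => //=; rewrite /deviates; apply/orP; right.
  have := approx_value_upper delta01 eps01 pt Gw nodev vt; rewrite leNgt.
  by case/orP: hv => // ->.
Qed.
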